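(* Let $G$ be a connected graph on $n$ vertices whose edge weights are $s\times s$ positive definite matrices, with Laplacian $L$ and resistance matrix $R$. Let $\tau$ be the $ns\times s$ matrix whose $i$-th $s\times s$ block is $\tau_i=2I_s-\sum_{j\sim i}W_{i,j}^{-1}R_{j,i}$. Then $R$ is nonsingular and $$R^{-1}=-\tfrac12 L+\tau(\tau'R\tau)^{-1}\tau'.$$
   Context: $G$ is a simple connected graph with vertex set $\{1,\dots,n\}$; each edge $\{i,j\}$ carries a weight $W_{i,j}=W_{j,i}$, a real $s\times s$ positive definite matrix; $j\sim i$ means adjacency. The Laplacian $L$ is the $ns\times ns$ block matrix with $(i,i)$ block $\sum_{j\sim i}W_{i,j}^{-1}$, $(i,j)$ block ($i\ne j$) equal to $-W_{i,j}^{-1}$ if $i\sim j$ and $0$ otherwise. Writing $K_{i,j}$ for the $s\times s$ blocks of the Moore--Penrose inverse $L^\dagger$, the resistance matrix $R$ is the $ns\times ns$ block matrix with blocks $R_{i,j}=K_{i,i}+K_{j,j}-2K_{i,j}$. $'$ denotes transpose.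
   Formalization: The graph is assumed to have n ≥ 2 vertices; for n = 1 (and s ≥ 1) the Laplacian and the resistance matrix R are both zero, so R is singular and the claim fails. *)

(* Defs.v *)
From mathcomp Require Import all_boot all_order all_algebra.
From mathcomp Require Export reals.
Set Implicit Arguments.
Unset Strict Implicit.
Unset Printing Implicit Defensive.
Import Order.TTheory GRing.Theory Num.Theory.
Local Open Scope ring_scope.

Definition posdefmx (R : realFieldType) (s : nat) (A : 'M[R]_s) : Prop :=
  A^T = A /\ forall x : 'cV[R]_s, x != 0 -> 0 < (x^T *m A *m x) 0 0.

Definition is_mpinv (R : realFieldType) (m n : nat)
    (A : 'M[R]_(m, n)) (X : 'M[R]_(n, m)) : bool :=
  [&& A *m X *m A == A, X *m A *m X == X,
      (A *m X)^T == A *m X & (X *m A)^T == X *m A].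

Lemma mulmx_tr_eq0 (R : realFieldType) (n : nat) (u : 'rV[R]_n) :
  u *m u^T = 0 -> u = 0.
Proof.
move=> /matrixP/(_ 0 0); rewrite !mxE => /eqP.
rewrite psumr_eq0 => [/allP u0|i _]; last by rewrite mxE -expr2 sqr_ge0.
apply/rowP=> i; have := u0 i (mem_index_enum i).
by rewrite !mxE mulf_eq0 orbb => /eqP.
Qed.

Lemma gram_unitmx (R : realFieldType) (m n : nat) (F : 'M[R]_(m, n)) :
  row_free F -> F *m F^T \in unitmx.
Proof.
move=> freeF; rewrite -row_free_unit -kermx_eq0; apply/rowV0P => u /sub_kermxP u0.
apply/eqP; rewrite -(mulmx_free_eq0 u freeF); apply/eqP/mulmx_tr_eq0.
by rewrite trmx_mul mulmxA -(mulmxA u) u0 mul0mx.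
Qed.

Lemma mpinv_factor (R : realFieldType) (m r n : nat)
    (C : 'M[R]_(m, r)) (F : 'M[R]_(r, n)) :
  C^T *m C \in unitmx -> F *m F^T \in unitmx ->
  is_mpinv (C *m F)
    (F^T *m invmx (F *m F^T) *m invmx (C^T *m C) *m C^T).
Proof.
move=> CU FU; set G := invmx (F *m F^T); set H := invmx (C^T *m C).
have AX : (C *m F) *m (F^T *m G *m H *m C^T) = C *m H *m C^T.
  by rewrite !mulmxA -(mulmxA C F) mulmxK.
have XA : (F^T *m G *m H *m C^T) *m (C *m F) = F^T *m G *m F.
  by rewrite !mulmxA -(mulmxA _ C^T C) -(mulmxA _ H) mulVmx // mulmx1.
have GT : G^T = G by rewrite trmx_inv trmx_mul trmxK.
have HT : H^T = H by rewrite trmx_inv trmx_mul trmxK.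
apply/and4P; split; apply/eqP.
- rewrite AX !mulmxA -(mulmxA _ C^T C).
  by rewrite -(mulmxA _ H) mulVmx // mulmx1.
- rewrite XA !mulmxA -(mulmxA _ F F^T).
  by rewrite mulmxK.
- by rewrite AX !trmx_mul trmxK HT mulmxA.
- by rewrite XA !trmx_mul trmxK GT mulmxA.
Qed.

Lemma mpinv_exists (R : realFieldType) (m n : nat) (A : 'M[R]_(m, n)) :
  exists X, is_mpinv A X.
Proof.
have FU := gram_unitmx (row_base_free A).
have CU : (col_base A)^T *m col_base A \in unitmx.
  rewrite -[X in _ *m X]trmxK; apply: gram_unitmx.
  by rewrite /row_free mxrank_tr; apply: col_base_full.
by have := mpinv_factor CU FU; rewrite mulmx_base; eexists; eassumption.
Qed.

Lemma is_mpinv_unique (R : realFieldType) (m n : nat) (A : 'M[R]_(m, n))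
    (X Y : 'M[R]_(n, m)) : is_mpinv A X -> is_mpinv A Y -> X = Y.
Proof.
case/and4P=> /eqP x1 /eqP x2 /eqP x3 /eqP x4.
case/and4P=> /eqP y1 /eqP y2 /eqP y3 /eqP y4.
have AXY : A *m X = A *m Y.
  by rewrite -[LHS]x3 -{1}y1 -(mulmxA _ A) trmx_mul x3 y3 mulmxA x1.
have XYA : X *m A = Y *m A.
  by rewrite -[LHS]x4 -{1}y1 -mulmxA mulmxA trmx_mul x4 y4 -mulmxA (mulmxA A) x1.
by rewrite -x2 XYA -mulmxA AXY mulmxA y2.
Qed.

(* The Moore-Penrose inverse; mathcomp's pinvmx is only a generalized inverse. *)
Definition mpinv (R : realFieldType) (m n : nat) (A : 'M[R]_(m, n)) :
  'M[R]_(n, m) := xchoose (mpinv_exists A).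

Lemma mpinvP (R : realFieldType) (m n : nat) (A : 'M[R]_(m, n)) :
  is_mpinv A (mpinv A).
Proof. exact: xchooseP. Qed.

(* [\sum_(i < n) s] is the size that mathcomp gives to an n-by-n array of
   s-by-s blocks. *)
Notation blockmx R n s := 'M[R]_(\sum_(i < n) s, \sum_(i < n) s).

Definition blk (R : realFieldType) (n s : nat) (A : blockmx R n s)
    (i j : 'I_n) : 'M[R]_s :=
  @submxblock R n n (fun=> s) (fun=> s) A i j.

Definition connected_graph (n : nat) (adj : rel 'I_n) : Prop :=
  [/\ symmetric adj, irreflexive adj & forall i j, connect adj i j].

(* Values of the weight off the edges are unconstrained and never used. *)
Definition posdef_weight (R : realFieldType) (n s : nat) (adj : rel 'I_n)
    (W : 'I_n -> 'I_n -> 'M[R]_s) : Prop :=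
  forall i j, adj i j -> W i j = W j i /\ posdefmx (W i j).

Definition laplacian (R : realFieldType) (n s : nat) (adj : rel 'I_n)
    (W : 'I_n -> 'I_n -> 'M[R]_s) : blockmx R n s :=
  \mxblock_(i < n, j < n)
    (if i == j then \sum_(k < n | adj k i) invmx (W i k)
     else if adj i j then - invmx (W i j) else 0).

Definition resistance (R : realFieldType) (n s : nat) (adj : rel 'I_n)
    (W : 'I_n -> 'I_n -> 'M[R]_s) : blockmx R n s :=
  let K := mpinv (laplacian adj W) in
  \mxblock_(i < n, j < n) (blk K i i + blk K j j - 2 *: blk K i j).

Definition tau (R : realFieldType) (n s : nat) (adj : rel 'I_n)
    (W : 'I_n -> 'I_n -> 'M[R]_s) : 'M[R]_(\sum_(i < n) s, s) :=
  \mxcol_(i < n)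
    (2 *: 1%:M
     - \sum_(j < n | adj j i) invmx (W i j) *m blk (resistance adj W) j i).

(* Main.v *)
(* Let E be the block column of identities, K the Moore-Penrose inverse of L
   and X the block column of the diagonal blocks of K.  Connectedness makes E
   span the kernel of L, so K E = 0 and L K = K L = I - E E'/n; moreover
   R = X E' + E X' - 2 K.  Hence L R = tau E' - 2 I with tau = L X + (2/n) E,
   which gives E' tau = 2 I, R tau = E M and tau' R tau = 2 M, where
   M = X' L X + (4/n) \sum_i K_ii.  As n > 1, no nonzero vector supported on a
   single block lies in the kernel of L, so every K_ii, and therefore M, is
   positive definite.  Finally
   R (- L/2 + tau (2 M)^-1 tau') = - (E tau' - 2 I)/2 + E tau'/2 = I. *)
Require Import Defs.
From mathcomp Require Import all_boot all_order all_algebra.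
Set Implicit Arguments.
Unset Strict Implicit.
Unset Printing Implicit Defensive.
Import Order.TTheory GRing.Theory Num.Theory.
Local Open Scope ring_scope.

(** * Positive definite matrices *)

Lemma pos_form_unitmx (R : realFieldType) (s : nat) (A : 'M[R]_s) :
  (forall x : 'cV[R]_s, x != 0 -> 0 < (x^T *m A *m x) 0 0) -> A \in unitmx.
Proof.
move=> posA; rewrite -row_free_unit -kermx_eq0; apply/rowV0P => u /sub_kermxP uA.
apply/eqP/negP => /negP u0.
have := posA u^T; rewrite trmx_eq0 => /(_ u0).
by rewrite trmxK uA mul0mx mxE ltxx.
Qed.

Lemma posdefmx_unitmx (R : realFieldType) (s : nat) (A : 'M[R]_s) :
  posdefmx A -> A \in unitmx.
Proof. by case=> _ /pos_form_unitmx. Qed.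

(** The substitution y = A^-1 x turns x' A^-1 x into y' A y. *)
Lemma posdefmx_inv (R : realFieldType) (s : nat) (A : 'M[R]_s) :
  posdefmx A -> posdefmx (invmx A).
Proof.
move=> pdA; have Au := posdefmx_unitmx pdA; case: pdA => symA posA.
split=> [|x x0]; first by rewrite trmx_inv symA.
have y0 : invmx A *m x != 0.
  by apply: contra_neq x0 => y0; rewrite -[x](mulKVmx Au) y0 mulmx0.
by have := posA _ y0; rewrite trmx_mul trmx_inv symA mulmxKV // mulmxA.
Qed.

Lemma posdefmx_ge0 (R : realFieldType) (s : nat) (A : 'M[R]_s) (x : 'cV[R]_s) :
  posdefmx A -> 0 <= (x^T *m A *m x) 0 0.
Proof.
case=> _ posA; have [->|x0] := eqVneq x 0; first by rewrite mulmx0 mxE.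
exact: ltW (posA x x0).
Qed.

Lemma posdefmx_eq0 (R : realFieldType) (s : nat) (A : 'M[R]_s) (x : 'cV[R]_s) :
  posdefmx A -> (x^T *m A *m x) 0 0 = 0 -> x = 0.
Proof.
case=> _ posA xAx; apply/eqP/negP => /negP /posA.
by rewrite xAx ltxx.
Qed.

Lemma connected_const (n : nat) (adj : rel 'I_n) (T : Type) (f : 'I_n -> T) :
  connected_graph adj -> (forall i j, adj i j -> f i = f j) ->
  forall i j, f i = f j.
Proof.
case=> _ _ conn eqf i j; have /connectP [p pth ->] := conn i j.
by elim: p i pth => //= k p IHp i /andP [/eqf-> /IHp].
Qed.

(** The [E] of the overview: the Kronecker product of the all-ones vector with the identity. *)
Definition blk_ones (R : realFieldType) (n s : nat) :
    'M[R]_(\sum_(i < n) s, s) :=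
  \mxcol_(i < n) 1%:M.

(** * The inverse formula as abstract matrix algebra, with [c] standing for n *)

Section ResistanceAlgebra.
Context (R : realFieldType) (N s : nat) (c : R) (L K : 'M[R]_N).
Context (E X : 'M[R]_(N, s)).
Context (c0 : c != 0) (symL : L^T = L) (symK : K^T = K).
Context (LE : L *m E = 0) (KE : K *m E = 0).
Context (EE : E^T *m E = c%:M) (KL : K *m L = 1%:M - c^-1 *: (E *m E^T)).

Let Q : 'M_N := X *m E^T + E *m X^T - 2 *: K.
Let t : 'M_(N, s) := L *m X + (2 / c) *: E.
(** Expanding [t] gives X' L X + (2/c) (X' E + E' X); for the actual [X] both products in the
    bracket are the sum of the K_ii. *)
Let M : 'M_s := X^T *m t + (2 / c) *: (E^T *m X).

Let EL : E^T *m L = 0.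
Proof. by apply: trmx_inj; rewrite trmx_mul symL trmxK LE trmx0. Qed.

Let LK : L *m K = 1%:M - c^-1 *: (E *m E^T).
Proof.
apply: trmx_inj; rewrite trmx_mul symL symK KL.
by rewrite [RHS]linearB /= trmx1 [(_ *: _)^T]linearZ /= trmx_mul trmxK.
Qed.

Let Et : E^T *m t = 2%:M.
Proof.
by rewrite mulmxDr mulmxA EL mul0mx add0r -scalemxAr EE scale_scalar_mx divfK.
Qed.

(** Since L E = 0, only L X E' - 2 L K remains, and the term (2/c) E E' of -2 L K completes L X to
    [t]. *)
Lemma laplacian_mul_resistance : L *m Q = t *m E^T - 2%:M.
Proof.
rewrite mulmxBr mulmxDr !mulmxA LE mul0mx addr0 -scalemxAr LK mulmxDl.
by rewrite -scalemxAl scalerBr scale_scalar_mx mulr1 scalerA opprB addrA.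
Qed.

Let QL : Q *m L = E *m t^T - 2%:M.
Proof.
have symQ : Q^T = Q.
  by rewrite /Q linearB /= linearD /= [(_ *: _)^T]linearZ /= !trmx_mul
      !trmxK symK addrC [X in _ + X]addrC addrC.
apply: trmx_inj; rewrite trmx_mul symL symQ laplacian_mul_resistance.
by rewrite linearB /= trmx_mul trmxK tr_scalar_mx.
Qed.

(** Here X E' t = 2 X, and K E = 0 gives 2 K t = 2 X - (2/c) E E' X; the terms 2 X cancel and [E]
    factors out on the left. *)
Lemma resistance_mul_tau : Q *m t = E *m M.
Proof.
rewrite mulmxBl mulmxDl -mulmxA Et -(mulmxA E) mul_mx_scalar.
rewrite -scalemxAl {2}/t (mulmxDr K) (mulmxA K) KL -scalemxAr KE scaler0 addr0.
rewrite mulmxBl mul1mx -scalemxAl scalerBr scalerA opprB.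
by rewrite addrC addrA subrK addrC [RHS]mulmxDr -[in RHS]scalemxAr -(mulmxA E).
Qed.

Lemma tau_resistance_tau : t^T *m Q *m t = 2 *: M.
Proof.
rewrite -mulmxA resistance_mul_tau mulmxA.
have -> : t^T *m E = 2%:M.
  by apply: trmx_inj; rewrite trmx_mul trmxK Et tr_scalar_mx.
by rewrite mul_scalar_mx.
Qed.

Lemma resistance_inv_formula : M \in unitmx ->
  [/\ t^T *m Q *m t \in unitmx,
      Q \in unitmx
    & invmx Q = - (1 / 2) *: L + t *m invmx (t^T *m Q *m t) *m t^T].
Proof.
move=> Mu; rewrite tau_resistance_tau.
have two0 : 2 != 0 :> R by rewrite pnatr_eq0.
have Mu2 : 2 *: M \in unitmx by rewrite unitmxZ ?unitfE.
set S := _ + _.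
have QS : Q *m S = 1%:M.
  rewrite mulmxDr -scalemxAr QL !mulmxA resistance_mul_tau invmxZ //.
  rewrite -scalemxAr mulmxK // -scalemxAl.
  rewrite div1r scaleNr scalerBr scale_scalar_mx mulVf // opprB.
  by rewrite subrK.
(* A right inverse of a square matrix is its inverse. *)
have [Qu _] := mulmx1_unit QS; split=> //.
by rewrite -[S](mulKmx Qu) QS mulmx1.
Qed.
End ResistanceAlgebra.

(** * The Laplacian: quadratic form and kernel *)

Lemma laplacian_mul (R : realFieldType) (n s p : nat) (adj : rel 'I_n)
    (W : 'I_n -> 'I_n -> 'M[R]_s) (Y : 'I_n -> 'M[R]_(s, p)) :
  connected_graph adj ->
  laplacian adj W *m \mxcol_(i < n) Y i =
  \mxcol_(i < n) \sum_(j < n | adj j i) invmx (W i j) *m (Y i - Y j).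
Proof.
case=> symA irrA _; rewrite mul_mxblock_mxrow; apply: eq_mxcol => i.
rewrite (bigD1 i) //= eqxx mulmx_suml [RHS](eq_bigr _ (fun j _ => mulmxBr _ _ _)).
rewrite sumrB; congr (_ + _); rewrite -sumrN big_mkcond [RHS]big_mkcond /=.
apply: eq_bigr => j _; rewrite symA eq_sym.
(* The left sum omits j = i because of [bigD1], the right one because [adj] is irreflexive. *)
have [<-|_] /= := eqVneq i j; first by rewrite irrA.
by case: ifP => _; rewrite ?mulNmx ?mul0mx.
Qed.

Lemma laplacian_sym (R : realFieldType) (n s : nat) (adj : rel 'I_n)
    (W : 'I_n -> 'I_n -> 'M[R]_s) :
  connected_graph adj -> posdef_weight adj W ->
  (laplacian adj W)^T = laplacian adj W.
Proof.
case=> symA irrA _ pdW; rewrite tr_mxblock; apply: eq_mxblock => i j.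
rewrite eq_sym; have [<-|_] := eqVneq i j.
  rewrite linear_sum; apply: eq_bigr => k; rewrite symA => /pdW [_].
  by case/posdefmx_inv.
rewrite symA; case: ifP => [/pdW [-> /posdefmx_inv [symW _]]|_]; last exact: trmx0.
by rewrite linearN /= symW.
Qed.

Lemma laplacian_blk_ones (R : realFieldType) (n s : nat) (adj : rel 'I_n)
    (W : 'I_n -> 'I_n -> 'M[R]_s) :
  connected_graph adj -> laplacian adj W *m blk_ones R n s = 0.
Proof.
move=> connA; rewrite laplacian_mul // -[RHS]mxcol0; apply: eq_mxcol => i.
by apply: big1 => j _; rewrite subrr mulmx0.
Qed.

(** The form sums y_i' W_ij^-1 (y_i - y_j) over ordered adjacent pairs; adding the copy with i and j
    exchanged completes each term to a form in y_i - y_j. *)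
Lemma laplacian_form (R : realFieldType) (n s : nat) (adj : rel 'I_n)
    (W : 'I_n -> 'I_n -> 'M[R]_s) (y : 'I_n -> 'cV[R]_s) :
  connected_graph adj -> posdef_weight adj W ->
  let x := \mxcol_(i < n) y i in
  2 * (x^T *m laplacian adj W *m x) 0 0 =
  \sum_(i < n) \sum_(j < n | adj j i)
     ((y i - y j)^T *m invmx (W i j) *m (y i - y j)) 0 0.
Proof.
move=> connA pdW x; have [symA _ _] := connA.
pose F i j := ((y i)^T *m invmx (W i j) *m (y i - y j)) 0 0.
have -> : (x^T *m laplacian adj W *m x) 0 0 = \sum_i \sum_(j | adj j i) F i j.
  rewrite -mulmxA laplacian_mul // tr_mxcol mul_mxrow_mxcol summxE.
  apply: eq_bigr => i _; rewrite mulmx_sumr summxE.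
  by apply: eq_bigr => j _; rewrite mulmxA.
have swap : \sum_i \sum_(j | adj j i) F i j = \sum_i \sum_(j | adj j i) F j i.
  by rewrite (exchange_big_dep xpredT) //=; apply: eq_bigr => i _;
     apply: eq_bigl => j.
rewrite mulr2n mulrDl mul1r {2}swap -big_split /=; apply: eq_bigr => i _.
rewrite -big_split /=; apply: eq_bigr => j /pdW [WE _].
rewrite /F WE -(opprB (y i)) mulmxN [(_ - _)^T]linearB /= !mulmxBl.
by rewrite [RHS]mxE [X in _ + X = _]mxE [X in _ = _ + X]mxE.
Qed.

Lemma laplacian_form_ge0 (R : realFieldType) (n s : nat) (adj : rel 'I_n)
    (W : 'I_n -> 'I_n -> 'M[R]_s) (x : 'cV[R]_(\sum_(i < n) s)) :
  connected_graph adj -> posdef_weight adj W ->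
  0 <= (x^T *m laplacian adj W *m x) 0 0.
Proof.
move=> connA pdW; have [symA _ _] := connA.
rewrite -(pmulr_rge0 _ (ltr0Sn R 1)) -(submxcolK x) laplacian_form //.
apply: sumr_ge0 => i _; apply: sumr_ge0 => j; rewrite symA => /pdW [_ pd].
exact/posdefmx_ge0/posdefmx_inv.
Qed.

(** A vanishing sum of nonnegative edge terms vanishes term by term, so the blocks agree across each
    edge, and connectedness propagates this. *)
Lemma laplacian_form_eq0 (R : realFieldType) (n s : nat) (adj : rel 'I_n)
    (W : 'I_n -> 'I_n -> 'M[R]_s) (x : 'cV[R]_(\sum_(i < n) s)) :
  connected_graph adj -> posdef_weight adj W ->
  (x^T *m laplacian adj W *m x) 0 0 = 0 ->
  forall i j, submxcol x i = submxcol x j.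
Proof.
move=> connA pdW /(congr1 ( *%R 2)); have [symA _ _] := connA.
rewrite -[in LHS](submxcolK x) laplacian_form // mulr0.
have ge0 i j : adj j i ->
    0 <= ((submxcol x i - submxcol x j)^T *m invmx (W i j)
          *m (submxcol x i - submxcol x j)) 0 0.
  by rewrite symA => /pdW [_ pd]; exact/posdefmx_ge0/posdefmx_inv.
move/psumr_eq0P => H; apply: (connected_const connA) => j i ji.
have /psumr_eq0P H' := H (fun i _ => sumr_ge0 _ (ge0 i)) i isT.
have /pdW [_ pd] : adj i j by rewrite symA.
apply/esym/subr0_eq/(posdefmx_eq0 (posdefmx_inv pd)).
exact: (H' (ge0 i)).
Qed.

Lemma laplacian_ker (R : realFieldType) (n s p : nat) (adj : rel 'I_n)
    (W : 'I_n -> 'I_n -> 'M[R]_s) (A : 'M[R]_(\sum_(i < n) s, p)) :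
  connected_graph adj -> posdef_weight adj W -> laplacian adj W *m A = 0 ->
  forall i j, submxcol A i = submxcol A j.
Proof.
move=> connA pdW LA i j; apply/matrixP => k l.
have form0 : ((col l A)^T *m laplacian adj W *m col l A) 0 0 = 0.
  by rewrite -mulmxA colE (mulmxA _ A) LA mul0mx mulmx0 mxE.
have /matrixP/(_ k 0) := laplacian_form_eq0 connA pdW form0 i j.
by rewrite !mxE.
Qed.

Lemma blk_ones_gram (R : realFieldType) (n s : nat) :
  (blk_ones R n s)^T *m blk_ones R n s = n%:R%:M.
Proof.
rewrite tr_mxcol mul_mxrow_mxcol.
rewrite (eq_bigr (fun=> 1%:M)) => [|i _]; last by rewrite trmx1 mulmx1.
by rewrite sumr_const card_ord -raddfMn.
Qed.

Lemma eq_submxcol_blk_ones (R : realFieldType) (n s p : nat) (i0 : 'I_n)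
    (A : 'M[R]_(\sum_(i < n) s, p)) :
  (forall i j, submxcol A i = submxcol A j) ->
  A = blk_ones R n s *m submxcol A i0.
Proof.
move=> eqA; rewrite mxcol_mul -[LHS]submxcolK; apply: eq_mxcol => i.
by rewrite mul1mx.
Qed.

(** * The Moore-Penrose inverse of a symmetric matrix and of the Laplacian *)

(** The transpose satisfies the same Penrose equations, the last two exchanging roles; uniqueness
    concludes. *)
Lemma mpinv_sym (R : realFieldType) (n : nat) (A : 'M[R]_n) :
  A^T = A -> (mpinv A)^T = mpinv A.
Proof.
move=> symA; have mpA := mpinvP A; apply: (is_mpinv_unique _ mpA).
case/and4P: mpA => /eqP m1 /eqP m2 /eqP m3 /eqP m4.
apply/and4P; split; apply/eqP.
- by apply: trmx_inj; rewrite !trmx_mul trmxK symA mulmxA m1.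
- by apply: trmx_inj; rewrite !trmx_mul trmxK symA mulmxA m2.
- by rewrite trmx_mul trmxK symA -{1}m4 trmx_mul symA.
- by rewrite trmx_mul trmxK symA -{1}m3 trmx_mul symA.
Qed.

Lemma mpinv_comm (R : realFieldType) (n : nat) (A : 'M[R]_n) :
  A^T = A -> A *m mpinv A = mpinv A *m A.
Proof.
move=> symA; case/and4P: (mpinvP A) => _ _ /eqP <- _.
by rewrite trmx_mul symA mpinv_sym.
Qed.

(** With K = [mpinv A], commutation gives A = A A K and K = K K A, so the two kernels coincide. *)
Lemma mpinv_mul_eq0 (R : realFieldType) (n p : nat) (A : 'M[R]_n)
    (B : 'M[R]_(n, p)) :
  A^T = A -> (mpinv A *m B == 0) = (A *m B == 0).
Proof.
move=> symA; case/and4P: (mpinvP A) => /eqP m1 /eqP m2 _ _.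
have AX := mpinv_comm symA.
apply/eqP/eqP => B0.
  by rewrite -m1 -(mulmxA A) -AX -!mulmxA B0 !mulmx0.
by rewrite -m2 -(mulmxA (mpinv A)) AX -!mulmxA B0 !mulmx0.
Qed.

(** The columns of I - K L lie in the kernel of L, so I - K L = E V; multiplying by E' and using E'
    K = 0 gives E' = n V. *)
Lemma mpinv_laplacian_mul (R : realFieldType) (n s : nat) (adj : rel 'I_n)
    (W : 'I_n -> 'I_n -> 'M[R]_s) :
  connected_graph adj -> posdef_weight adj W -> (0 < n)%N ->
  let L := laplacian adj W in let E := blk_ones R n s in
  mpinv L *m L = 1%:M - n%:R^-1 *: (E *m E^T).
Proof.
move=> connA pdW n0 L E; have symL : L^T = L := laplacian_sym connA pdW.
have /eqP KE : mpinv L *m E == 0 by rewrite mpinv_mul_eq0 // laplacian_blk_ones.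
set P := _ *m L; pose i0 := Ordinal n0.
have LP0 : L *m (1%:M - P) = 0.
  case/and4P: (mpinvP L) => /eqP m1 _ _ _.
  by rewrite mulmxBr mulmx1 mulmxA m1 subrr.
have PE := eq_submxcol_blk_ones i0 (laplacian_ker connA pdW LP0).
set V := submxcol _ _ in PE.
have EP : E^T *m P = 0.
  apply: trmx_inj; rewrite !trmx_mul trmxK symL mpinv_sym // -mulmxA KE.
  by rewrite mulmx0 trmx0.
have VE : V = n%:R^-1 *: E^T.
  have : E^T *m (1%:M - P) = n%:R *: V.
    by rewrite PE mulmxA blk_ones_gram mul_scalar_mx.
  rewrite mulmxBr mulmx1 EP subr0 => ->.
  by rewrite scalerA mulVf ?scale1r // pnatr_eq0 -lt0n.
by rewrite scalemxAr -VE -PE opprB addrC subrK.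
Qed.

Lemma mpinv_laplacian_blk_gt0 (R : realFieldType) (n s : nat) (adj : rel 'I_n)
    (W : 'I_n -> 'I_n -> 'M[R]_s) (i : 'I_n) (v : 'cV[R]_s) :
  connected_graph adj -> posdef_weight adj W -> (1 < n)%N -> v != 0 ->
  0 < (v^T *m blk (mpinv (laplacian adj W)) i i *m v) 0 0.
Proof.
move=> connA pdW n1 v0; set L := laplacian adj W; set K := mpinv L.
have symL : L^T = L := laplacian_sym connA pdW.
have symK : K^T = K by apply: mpinv_sym.
have KLK : K *m L *m K = K by case/and4P: (mpinvP L) => _ /eqP.
(* With [y] supported on block i, v' K_ii v = y' K y, which is the Laplacian form at K y because K =
   K L K. *)
pose y : 'cV[R]_(\sum_(k < n) s) := \mxcol_(k < n) (if k == i then v else 0).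
have Ky : K *m y = \mxcol_k (blk K k i *m v).
  rewrite -[in LHS](submxblockK K) mul_mxblock_mxrow; apply: eq_mxcol => k.
  rewrite (bigD1 i) //= eqxx [X in _ + X]big1 ?addr0 // => j /negPf ->.
  by rewrite mulmx0.
have -> : v^T *m blk K i i *m v = (K *m y)^T *m L *m (K *m y).
  rewrite trmx_mul symK mulmxA -(mulmxA y^T) -(mulmxA y^T) KLK.
  rewrite -[RHS]mulmxA Ky tr_mxcol mul_mxrow_mxcol (bigD1 i) //= eqxx.
  rewrite [X in _ + X]big1 ?addr0 ?mulmxA // => k /negPf ->.
  by rewrite trmx0 mul0mx.
rewrite lt_neqAle laplacian_form_ge0 // andbT eq_sym.
(* If the form vanishes, K y lies in the span of [E], so K y = K L K y = 0 and then L y = 0: all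
   blocks of [y] agree, and a second vertex forces v = 0. *)
apply: contra_neq v0 => /(laplacian_form_eq0 connA pdW) /(eq_submxcol_blk_ones i)
  KyE.
have : K *m y == 0.
  by rewrite -KLK -!mulmxA KyE (mulmxA L) laplacian_blk_ones // mul0mx mulmx0.
rewrite mpinv_mul_eq0 // => /eqP /(laplacian_ker connA pdW) eqy.
have [j ji] : exists j, j != i.
  apply/existsP; rewrite -negb_forall; apply: contraL n1 => /forallP eqi.
  rewrite -leqNgt -[n]card_ord; apply/fintype_le1P => a b.
  by rewrite (eqP (eqi a)) (eqP (eqi b)).
by have := eqy i j; rewrite !mxcolK eqxx (negPf ji).
Qed.

(** * The resistance matrix and [tau] in terms of [E] and [X] *)

Lemma resistanceE (R : realFieldType) (n s : nat) (adj : rel 'I_n)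
    (W : 'I_n -> 'I_n -> 'M[R]_s) :
  connected_graph adj -> posdef_weight adj W ->
  let K := mpinv (laplacian adj W) in let E := blk_ones R n s in
  let X := \mxcol_(i < n) blk K i i in
  resistance adj W = X *m E^T + E *m X^T - 2 *: K.
Proof.
move=> connA pdW K E X; have symK : K^T = K by apply/mpinv_sym/laplacian_sym.
apply/mxblockP => i j; rewrite mxblockK submxblockB submxblockD.
rewrite !tr_mxcol !mul_mxcol_mxrow !mxblockK trmx1 mulmx1 mul1mx.
(* Block (i, j) of E X' is the transpose of K_jj, equal to K_jj by symmetry of [K]. *)
rewrite [in RHS]tr_submxblock symK; congr (_ - _).
by apply/matrixP => k l; rewrite !mxE.
Qed.

(** Both sides are compared through block (i, i) of L R: it is t_i - 2 I because L R = t E' - 2 I,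
    and tau_i - 2 I by [laplacian_mul]. *)
Lemma tauE (R : realFieldType) (n s : nat) (adj : rel 'I_n)
    (W : 'I_n -> 'I_n -> 'M[R]_s) :
  connected_graph adj -> posdef_weight adj W -> (0 < n)%N ->
  let L := laplacian adj W in
  tau adj W = L *m (\mxcol_(i < n) blk (mpinv L) i i)
              + (2 / n%:R) *: blk_ones R n s.
Proof.
move=> connA pdW n0 L; set X := mxcol _; set E := blk_ones _ _ _; set t := RHS.
have symL : L^T = L := laplacian_sym connA pdW.
have LE : L *m E = 0 by apply: laplacian_blk_ones.
have := laplacian_mul_resistance X symL (mpinv_sym symL) LE
          (mpinv_laplacian_mul connA pdW n0).
rewrite -/X -/E -/t -resistanceE // => LR.
apply/mxcolP => i; rewrite mxcolK.
have -> : submxcol t i = 2%:M + submxblock (L *m resistance adj W) i i.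
  rewrite LR submxblockB submxblockEv -submxcol_mul tr_mxcol -mul_submxrow.
  rewrite mxrowK trmx1 mulmx1 addrC -addrA [X in _ + X]addrC.
  suff -> : submxblock (2%:M : blockmx R n s) i i = 2%:M by rewrite subrr addr0.
  by rewrite -mxdiagZ submxblock_diag.
rewrite scalemx1 -[in RHS](submxcolK (resistance adj W)) laplacian_mul //.
rewrite submxblockEv mxcolK submxrow_sum -sumrN; congr (_ + _).
apply: eq_bigr => j _; rewrite -mul_submxrow submxrowB -!submxblockEv.
(* The diagonal blocks of the resistance matrix vanish, so R_ii - R_ji reduces to - R_ji. *)
rewrite [submxblock _ i i]mxblockK.
suff -> : forall B : 'M[R]_s, B + B - 2 *: B = 0 by rewrite sub0r mulmxN.
by move=> B; rewrite scaler_nat mulr2n subrr.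
Qed.

Theorem theorem4p2 (R : realType) (n s : nat) (adj : rel 'I_n)
    (W : 'I_n -> 'I_n -> 'M[R]_s)
    (n_ge2 : (1 < n)%N)
    (conn_adj : connected_graph adj)
    (posdef_W : posdef_weight adj W) :
  let L := laplacian adj W in
  let Rm := resistance adj W in
  let t := tau adj W in
  [/\ t^T *m Rm *m t \in unitmx,
      Rm \in unitmx
    & invmx Rm = - (1 / 2) *: L + t *m invmx (t^T *m Rm *m t) *m t^T].
Proof.
move=> L Rm t; have n_gt0 : (0 < n)%N := ltnW n_ge2.
have symL : L^T = L := laplacian_sym conn_adj posdef_W.
have LE : L *m blk_ones R n s = 0 by apply: laplacian_blk_ones.
have /eqP KE : mpinv L *m blk_ones R n s == 0 by rewrite mpinv_mul_eq0 // LE.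
rewrite /Rm /t resistanceE // tauE // -/L.
apply: resistance_inv_formula (mpinv_sym symL) _ _ _ _ _ => //.
- by rewrite pnatr_eq0 -lt0n.
- exact: blk_ones_gram.
- exact: mpinv_laplacian_mul.
(* What remains is the invertibility of [M], obtained from positivity of its form. *)
set X := mxcol _; set E := blk_ones _ _ _.
have EX : E^T *m X = \sum_i blk (mpinv L) i i.
  rewrite tr_mxcol mul_mxrow_mxcol; apply: eq_bigr => i _.
  by rewrite trmx1 mul1mx.
have XE : X^T *m E = E^T *m X.
  rewrite EX tr_mxcol mul_mxrow_mxcol; apply: eq_bigr => i _.
  by rewrite mulmx1 tr_submxblock mpinv_sym.
apply: pos_form_unitmx => v v0.
rewrite [X^T *m _]mulmxDr -scalemxAr XE -addrA -scalerDl EX mulmxDr mulmxDl mxE.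
(* The summand X' L X is only nonnegative; strictness comes from the multiple 2/n + 2/n of the sum
   of the K_ii. *)
apply: ltr_wpDl.
  have -> : v^T *m (X^T *m (L *m X)) *m v = (X *m v)^T *m L *m (X *m v).
    by rewrite trmx_mul !mulmxA.
  exact: laplacian_form_ge0.
rewrite -scalemxAr -scalemxAl mxE mulr_gt0 //.
  by rewrite addr_gt0 // divr_gt0 // ltr0n.
rewrite mulmx_sumr mulmx_suml summxE (bigD1 (Ordinal n_gt0)) //=.
apply: ltr_pwDl; first exact: mpinv_laplacian_blk_gt0.
by apply: sumr_ge0 => i _; apply/ltW/mpinv_laplacian_blk_gt0.
Qed.
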